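(* Let $S^2(1)=\{(x_0,x_1,x_2)\in\mathbb{R}^3\mid x_0^2-x_1^2=1\}$ be the semi-Euclidean sphere of unit radius, with the degenerate metric induced from the scalar product $(x,y)=x_0y_0-x_1y_1$ on $\mathbb{R}^3$. Let $S:S^2(1)\to C^2$ be the stereographic map from the pole $N=(1,0,0)$ onto the plane $x_0=0$, given by $$x=\frac{x_1}{1-x_0},\qquad y=\frac{x_2}{1-x_0},$$ and extended to the line $\{x_0=1,\ x_1=0\}$ through the pole by sending this line to the ideal line of the enlarged plane $C^2$. Then $S$ is a conformal map.
   Context: The scalar product $(x,y)=x_0y_0-x_1y_1$ has rank 2. It comes from the 3-dimensional unital associative real algebra with basis $\{\mathbf 1,e_1,e_2\}$ and multiplication $e_1^2=\mathbf 1$, $e_2^2=0$, $e_1e_2=-e_2e_1=e_2$, via $(x,y)=\frac12(x\overline y+y\overline x)$ with $x=x_0+x_1e_1+x_2e_2$ and $\overline x=x_0-x_1e_1-x_2e_2$. The sphere is parametrized by $\mathbf r(u,\varphi)=\varepsilon(\cosh\varphi,\sinh\varphi,u\exp\varphi)$, where $\varepsilon=\pm1$ labels its two connected components and $u,\varphi\in\mathbb{R}$. In these coordinates its metric has linear element $ds_1^2=-d\varphi^2$. The plane $x_0=0$ has coordinates $x$ (along the $x_1$-axis) and $y$ (along the $x_2$-axis). Stereographic projection from $N$ of the sphere without the line $\{x_0=1,x_1=0\}$ has image $Q=\{(x,y)\mid x\neq\pm1\}$. The plane $C^2$ is obtained from $Q$ by adding an infinitely distant point (the image of $N$) and an ideal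 line through it (the image of the line $x_0=1$, $x_1=0$), identified with the points $x=\pm\infty$; this connects the parts $x<-1$ and $x>1$ of $Q$. With this enlargement the stereographic map becomes a diffeomorphism $S$. The metric induced on $C^2$ is $d\widetilde s^{\,2}=-dx^2$ in the coordinates $x,y$. Conformal means that the linear element of the sphere differs from that of $C^2$ by a conformal factor; in the coordinates $(x,y)$ the relation is $ds_1^2=\frac{4}{(x^2-1)^2}\,d\widetilde s^{\,2}$. *)

(* Defs.v *)
From HB Require Import structures.
From mathcomp Require Import all_boot all_order all_algebra.
From mathcomp Require Import all_classical all_reals all_analysis.

Set Implicit Arguments.
Unset Strict Implicit.
Unset Printing Implicit Defensive.

Import Order.TTheory GRing.Theory Num.Theory.
Import numFieldNormedType.Exports.

Local Open Scope classical_set_scope.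
Local Open Scope ring_scope.

Section Smooth.
Variable R : realType.

(* [Ck k U f]: f is of class C^k on U; only used for open U. *)
Fixpoint Ck (n k : nat) (U : set 'rV[R]_n) (f : 'rV[R]_n -> R) : Prop :=
  match k with
  | 0 => forall x, U x -> {for x, continuous f}
  | k'.+1 => (forall x, U x -> differentiable f x) /\
             (forall i : 'I_n, Ck k' U (fun x => 'D_(delta_mx 0 i) f x))
  end.

Definition smooth (n : nat) (U : set 'rV[R]_n) (f : 'rV[R]_n -> R) : Prop :=
  forall k, Ck k U f.

(* Smoothness on an arbitrary subset A of R^n, by local smooth extension; for
   an embedded submanifold A this is smoothness on the manifold A. *)
Definition smooth_on (n m : nat) (A : set 'rV[R]_n)
    (f : 'rV[R]_n -> 'rV[R]_m) : Prop :=
  forall p, A p -> exists (U : set 'rV[R]_n) (F : 'rV[R]_n -> 'rV[R]_m),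
    [/\ open U, U p, forall j, smooth U (fun x => F x 0 j) &
        forall x, A x -> U x -> F x = f x].

End Smooth.

Section SemiEuclideanSphere.
Variable R : realType.

Definition vec2 (a b : R) : 'rV[R]_2 := \row_(i < 2) nth 0 [:: a; b] i.
Definition vec3 (a b c : R) : 'rV[R]_3 := \row_(i < 3) nth 0 [:: a; b; c] i.

Definition scal (v w : 'rV[R]_3) : R := v 0 0 * w 0 0 - v 0 1 * w 0 1.

Definition sphere : set 'rV[R]_3 := [set p | scal p p = 1].

Definition linear_element (g : R -> 'rV[R]_3) (t : R) : R :=
  scal (derive1 g t) (derive1 g t).

Definition plane_pt (q : 'rV[R]_2) : 'rV[R]_3 := vec3 0 (q 0 0) (q 0 1).

Definition Q : set 'rV[R]_2 := [set q | q 0 0 != 1 /\ q 0 0 != -1].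

(* The plane with its ideal line x = +-oo.  A curve going to infinity meets the
   ideal line at [Ideal c] when y / x^2 tends to c, so that the point at infinity
   (the image of the pole) is [Ideal 0]. *)
Inductive enlarged_plane : Type :=
  | Proper of 'rV[R]_2
  | Ideal of R.

Definition C2 : set enlarged_plane :=
  [set c | match c with Proper q => Q q | Ideal _ => True end].

(* The inversion (x, y) |-> (x, y) / x^2 of the plane. *)
Definition inversion (q : 'rV[R]_2) : 'rV[R]_2 :=
  vec2 ((q 0 0)^-1) (q 0 1 / q 0 0 ^+ 2).

(* C2 is a surface with two charts, both with image Q: the coordinates (x, y),
   defined off the ideal line, and the inverted coordinates (1/x, y/x^2), defined
   off the line x = 0, in which the ideal line is the axis 1/x = 0. *)
Inductive chart := Affine | Inverted.

Definition chart_dom (k : chart) : set enlarged_plane :=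
  match k with
  | Affine => [set c | match c with Proper q => Q q | Ideal _ => False end]
  | Inverted =>
      [set c | match c with Proper q => Q q /\ q 0 0 != 0 | Ideal _ => True end]
  end.

Definition chart_coord (k : chart) (c : enlarged_plane) : 'rV[R]_2 :=
  match k, c with
  | Affine, Proper q => q
  | Affine, Ideal _ => 0 (* outside [chart_dom Affine] *)
  | Inverted, Proper q => inversion q
  | Inverted, Ideal a => vec2 0 a
  end.

Definition chart_param (k : chart) (q : 'rV[R]_2) : enlarged_plane :=
  match k with
  | Affine => Proper q
  | Inverted => if q 0 0 == 0 then Ideal (q 0 1) else Proper (inversion q)
  end.

Lemma vec2E0 (a b : R) : vec2 a b 0 0 = a. Proof. by rewrite mxE. Qed.
Lemma vec2E1 (a b : R) : vec2 a b 0 1 = b. Proof. by rewrite mxE. Qed.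

Lemma vec2_eta (q : 'rV[R]_2) : vec2 (q 0 0) (q 0 1) = q.
Proof.
apply/rowP => i; rewrite mxE.
case: i => [[|[|i]] lti] //=; congr (q 0 _); exact: val_inj.
Qed.

Lemma inversionK (q : 'rV[R]_2) : q 0 0 != 0 -> inversion (inversion q) = q.
Proof.
move=> q0; rewrite /inversion !vec2E0 !vec2E1 invrK exprVn invrK.
by rewrite divfK ?expf_neq0 // vec2_eta.
Qed.

Lemma inversion_Q (q : 'rV[R]_2) : Q q -> Q (inversion q).
Proof.
move=> [q1 qN1]; rewrite /Q /= /inversion !vec2E0; split.
- by rewrite -invr1 (inj_eq invr_inj).
- by rewrite -[X in - X]invr1 -invrN (inj_eq invr_inj).
Qed.

Lemma chart_param_dom k : set_fun Q (chart_dom k) (chart_param k).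
Proof.
case: k => q qQ //=; case: eqP => // /eqP q0; split; first exact: inversion_Q.
by rewrite vec2E0 invr_eq0.
Qed.

Lemma chart_coord_Q k : set_fun (chart_dom k) Q (chart_coord k).
Proof.
case: k => -[q|a] //=; first by case=> qQ _; exact: inversion_Q.
by rewrite /Q /= vec2E0 !(eq_sym 0) oppr_eq0 oner_eq0.
Qed.

Lemma chart_paramK k q : Q q -> chart_coord k (chart_param k q) = q.
Proof.
case: k => //= qQ; case: eqP => [q0|/eqP q0] /=; last exact: inversionK.
by rewrite -[RHS]vec2_eta q0.
Qed.

Lemma chart_coordK k c : chart_dom k c -> chart_param k (chart_coord k c) = c.
Proof.
case: k; case: c => [q|a] //=; last by rewrite vec2E0 eqxx vec2E1.
by case=> _ q0; rewrite vec2E0 invr_eq0 (negPf q0) inversionK.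
Qed.

Lemma C2_chart_dom : C2 = chart_dom Affine `|` chart_dom Inverted.
Proof.
apply/seteqP; split => -[q|a] //=; [by left|by right|by case=> // -[]].
Qed.

(* On the line x0 = 1, x1 = 0 of the sphere the value is forced by continuity:
   y / x^2 = - x2 / (1 + x0) at the points of the sphere with x1 != 0. *)
Definition stereo (p : 'rV[R]_3) : enlarged_plane :=
  if p 0 0 == 1 then Ideal (- (p 0 2 / 2))
  else Proper (vec2 (p 0 1 / (1 - p 0 0)) (p 0 2 / (1 - p 0 0))).

Definition smooth_to_C2 (f : 'rV[R]_3 -> enlarged_plane) : Prop :=
  forall p k, sphere p -> chart_dom k (f p) ->
    exists U : set 'rV[R]_3,
      [/\ open U, U p, forall q, sphere q -> U q -> chart_dom k (f q) &
          smooth_on (sphere `&` U) (chart_coord k \o f)].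

(* As the sphere is embedded in R^3, the inverse is smooth into the sphere if and
   only if it is smooth into R^3. *)
Definition diffeomorphism (f : 'rV[R]_3 -> enlarged_plane) : Prop :=
  [/\ set_bij sphere C2 f, smooth_to_C2 f &
      exists g : enlarged_plane -> 'rV[R]_3,
        (forall p, sphere p -> g (f p) = p) /\
        (forall k, smooth_on Q (g \o chart_param k))].

(* ds_1^2 = lam * ds~^2 along every curve on the sphere, where ds~^2 is the
   metric induced from R^3 on the coordinate plane of the chart k (in the affine
   chart: - dx^2). *)
Definition conformal_factor (f : 'rV[R]_3 -> enlarged_plane) (k : chart)
    (lam : 'rV[R]_2 -> R) : Prop :=
  forall (g : R -> 'rV[R]_3) (t : R),
    (forall s, sphere (g s)) -> derivable g t 1 -> chart_dom k (f (g t)) ->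
    linear_element g t =
      lam (chart_coord k (f (g t))) *
      linear_element (fun s => plane_pt (chart_coord k (f (g s)))) t.

(* The form - dx^2 has no finite limit on the ideal line, but its conformal class
   extends: with x' = 1/x one has - dx'^2 = - dx^2 / x^4, so - dx'^2 represents
   the same class in the inverted chart and is regular on the ideal line. *)
Definition conformal_map (f : 'rV[R]_3 -> enlarged_plane) : Prop :=
  diffeomorphism f /\
  forall k, exists lam : 'rV[R]_2 -> R,
    [/\ forall q, Q q -> 0 < lam q, smooth Q lam & conformal_factor f k lam].

End SemiEuclideanSphere.

Arguments stereo {R}.
Arguments conformal_map {R}.
Arguments conformal_factor {R}.

(* Main.v *)
Require Import Defs.
From mathcomp Require Import all_boot all_order all_algebra.
From mathcomp Require Import all_classical all_reals all_analysis.
From mathcomp Require Import ring lra.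
Import GRing.Theory Num.Theory.
Import numFieldNormedType.Exports.
Local Open Scope classical_set_scope.
Local Open Scope ring_scope.

(** Both charts of the enlarged plane are treated at once.  With e = 1 in the
affine chart and e = -1 in the inverted one, the stereographic map reads
p |-> e (p1, p2) / (1 - e p0) on the open set 1 - e p0 != 0: the antipodal map
of the sphere exchanges the two charts.  Its inverse is
(x, y) |-> e (x^2 + 1, - 2 x, - 2 y) / (x^2 - 1), so that both maps are rational
with nonvanishing denominators, hence smooth.  As x^2 - 1 = - 2 / (1 - e p0),
differentiating x along a curve on the sphere and using p0 dp0 = p1 dp1 gives
the factor 4 / (x^2 - 1)^2 in both charts. *)

(** Differentiability depends only on the germ: the first-order expansion of [f] at [x] is also one
    for [g], and uniqueness identifies the two differentials. *)
Lemma near_eq_differentiable (R : numFieldType) (V W : normedModType R)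
    (f g : V -> W) (x : V) :
  (\near x, f x = g x) -> differentiable f x -> differentiable g x.
Proof.
move=> fg /diff_locallyP[cdf fE].
have fg0 : \forall y \near (0 : V), f (y + x) = g (y + x).
  have := fg; rewrite (near_shift 0 x).
  by apply: filterS => y /=; rewrite subr0.
have gE : g \o shift x = cst (g x) + 'd f x +o_ (0 : V) id.
  apply/eqaddoP => e e0; have /eqaddoP/(_ _ e0) := fE.
  apply: filterS2 fg0 => y /= fgy.
  by rewrite !fctE /= fgy (nbhs_singleton fg).
by apply/diff_locallyP; rewrite (diff_unique cdf gE).
Qed.

(** * Rational functions on an open set and their smoothness *)

Section RationalFunctions.
Context {R : realType} {n : nat}.
Implicit Types (U : set 'rV[R]_n) (f g : 'rV[R]_n -> R).

(* Closure under equality on U makes the class stable under differentiation,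
   hence contained in the smooth functions. *)
Inductive rational U : ('rV[R]_n -> R) -> Prop :=
  | rational_cst c : rational U (fun=> c)
  | rational_coord i : rational U (fun x => x 0 i)
  | rational_add f g :
      rational U f -> rational U g -> rational U (fun x => f x + g x)
  | rational_mul f g :
      rational U f -> rational U g -> rational U (fun x => f x * g x)
  | rational_inv f : (forall x, U x -> f x != 0) ->
      rational U f -> rational U (fun x => (f x)^-1)
  | rational_ext f g : (forall x, U x -> f x = g x) ->
      rational U f -> rational U g.

Lemma rational_opp U f : rational U f -> rational U (fun x => - f x).
Proof.
move=> Uf; apply: (rational_ext U (fun x => -1 * f x)).
  by move=> x _; rewrite mulN1r.
by apply: rational_mul => //; exact: rational_cst.
Qed.

Lemma rational_exp U f k : rational U f -> rational U (fun x => f x ^+ k).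
Proof.
move=> Uf; elim: k => [|k IHk].
  by apply: (rational_ext U (fun=> 1)) (rational_cst _ _) => x _; rewrite expr0.
apply: (rational_ext U (fun x => f x * f x ^+ k)) (rational_mul _ _ _ Uf IHk).
by move=> x _; rewrite exprS.
Qed.

(** Induction on the construction of [f]: every differentiation rule stays inside the class.
    Openness of [U] serves the [rational_ext] case, where equality on [U] has to hold near each
    point. *)
Lemma rational_derivative U f : open U -> rational U f ->
  (forall x, U x -> differentiable f x) /\
  (forall v, rational U (fun x => 'D_v f x)).
Proof.
move=> oU; elim=> {f}.
- move=> c; split=> [x _|v]; first exact: differentiable_cst.
  apply: (rational_ext U (fun=> 0)) (rational_cst _ _) => x _.
  by rewrite derive_cst.
- move=> i; split=> [x _|v]; first exact: differentiable_coord.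
  apply: (rational_ext U (fun=> v 0 i)) (rational_cst _ _) => x _.
  (* The derivative of a coordinate is read off as an entry of the derivative of the identity. *)
  have /derive_mx : derivable (@id 'rV[R]_n) x v by exact: derivable_id.
  by rewrite derive_id => /matrixP/(_ 0 i); rewrite mxE.
- move=> f g Uf [df Df] Ug [dg Dg]; split=> [x Ux|v].
    by apply: differentiableD; [exact: df|exact: dg].
  apply: (rational_ext U _ _ _ (rational_add U _ _ (Df v) (Dg v))) => x Ux.
  by rewrite -deriveD //; apply: diff_derivable; [exact: df|exact: dg].
- move=> f g Uf [df Df] Ug [dg Dg]; split=> [x Ux|v].
    by apply: differentiableM; [exact: df|exact: dg].
  apply: (rational_ext U _ _ _ (rational_add U _ _
    (rational_mul U _ _ Uf (Dg v)) (rational_mul U _ _ Ug (Df v)))) => x Ux.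
  by rewrite -deriveM //; apply: diff_derivable; [exact: df|exact: dg].
- move=> f f0 Uf [df Df]; split=> [x Ux|v].
    by apply: differentiableV; [exact: df|exact: f0].
  apply: (rational_ext U (fun x => - ((f x)^-1 ^+ 2 * 'D_v f x))).
    move=> x Ux; rewrite deriveV; [by rewrite exprVn -mulNr| exact: f0|].
    exact/diff_derivable/df.
  by apply/rational_opp/rational_mul => //; exact/rational_exp/rational_inv.
- move=> f g fg Uf [df Df].
  have nfg x : U x -> \near x, f x = g x.
    by move=> Ux; apply: filterS fg _; exact: open_nbhs_nbhs.
  split=> [x Ux|v].
    exact: near_eq_differentiable (nfg x Ux) (df x Ux).
  apply: (rational_ext U _ _ _ (Df v)) => x Ux.
  exact/near_eq_derive/nfg.
Qed.

Lemma rational_smooth U f : open U -> rational U f -> smooth U f.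
Proof.
move=> oU + k; elim: k f => [|k IHk] f /(rational_derivative U f oU) [df Df] /=.
  by move=> x /df; exact: differentiable_continuous.
by split=> // i; exact: IHk.
Qed.

Lemma open_rational_neq0 f :
  rational setT f -> open [set x | f x != 0].
Proof.
move=> /(rational_derivative _ _ openT)[df _].
apply: (@open_comp _ _ f [set y | y != 0]).
  by move=> x _; exact/differentiable_continuous/df.
exact: open_neq.
Qed.

End RationalFunctions.

(** Follows the syntax of the formula; only the nonvanishing of denominators is left to prove. *)
Ltac rational_tac := repeat first
  [ exact: rational_cst | exact: rational_coord | apply: rational_opp
  | apply: rational_exp | apply: rational_add | apply: rational_mul
  | apply: rational_inv ].

(** * The stereographic map and its inverse in the two charts *)

Section Stereographic.
Context {R : realType}.
Implicit Types (p : 'rV[R]_3) (q : 'rV[R]_2) (c : enlarged_plane R) (k : chart).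

Definition chart_sign k : R := if k is Affine then 1 else -1.

Definition stereo_coord k p : 'rV[R]_2 :=
  vec2 (chart_sign k * p 0 1 / (1 - chart_sign k * p 0 0))
       (chart_sign k * p 0 2 / (1 - chart_sign k * p 0 0)).

Definition stereo_inv_coord k q : 'rV[R]_3 :=
  vec3 (chart_sign k * (q 0 0 ^+ 2 + 1) / (q 0 0 ^+ 2 - 1))
       (- 2 * chart_sign k * q 0 0 / (q 0 0 ^+ 2 - 1))
       (- 2 * chart_sign k * q 0 1 / (q 0 0 ^+ 2 - 1)).

(** On the ideal line the affine formula has no value, so the inverted one takes over and gives the
    point (1, 0, -2a). *)
Definition stereo_inv c : 'rV[R]_3 :=
  match c with
  | Proper q => stereo_inv_coord Affine q
  | Ideal a => stereo_inv_coord Inverted (vec2 0 a)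
  end.

Lemma vec3E (a b d : R) :
  (vec3 a b d 0 0 = a) * (vec3 a b d 0 1 = b) * (vec3 a b d 0 2 = d).
Proof. by rewrite !mxE. Qed.

Lemma vec3_eta p : vec3 (p 0 0) (p 0 1) (p 0 2) = p.
Proof.
apply/rowP => i; rewrite mxE.
by case: i => [[|[|[|i]]] lti] //=; congr (p 0 _); exact: val_inj.
Qed.

Lemma sphereE p : sphere p <-> p 0 0 ^+ 2 = 1 + p 0 1 ^+ 2.
Proof. by rewrite /sphere /scal /= -!expr2; split=> h; lra. Qed.

Lemma QE q : Q q <-> q 0 0 ^+ 2 - 1 != 0.
Proof.
rewrite subr_eq0 sqrf_eq1 negb_or /Q /=.
by split=> [[-> ->]//|/andP[-> ->]].
Qed.

Lemma chart_sign_sqr k : chart_sign k ^+ 2 = 1.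
Proof. by case: k; rewrite /= ?sqrrN expr1n. Qed.

(** Off the line p0 = 1, the identity x^2 - 1 = -2 / (1 - p0) puts the image in [Q]. The inverted
    chart then misses only x = 0, that is p1 = 0, which on the sphere means p0 = -1. *)
Lemma chart_dom_stereo k p : sphere p ->
  chart_dom k (stereo p) <-> 1 - chart_sign k * p 0 0 != 0.
Proof.
move=> /sphereE sp; rewrite /stereo subr_eq0; case: eqVneq => [p0|p0].
  by case: k; rewrite /= p0 ?mul1r ?eqxx // mulN1r; split=> // _; lra.
have d0 : 1 - p 0 0 != 0 by lra.
have xQ b : Q (vec2 (p 0 1 / (1 - p 0 0)) b).
  apply/QE; rewrite vec2E0.
  have -> : (p 0 1 / (1 - p 0 0)) ^+ 2 - 1 = - 2 / (1 - p 0 0).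
    by field: sp.
  by rewrite mulf_neq0 ?invr_eq0 // oppr_eq0 pnatr_eq0.
case: k => /=.
  by rewrite mul1r eq_sym p0.
rewrite vec2E0 mulf_eq0 invr_eq0 (negPf d0) orbF mulN1r.
split=> [[_]|h]; last split=> //.
  by apply: contra_neq => e; apply/eqP; rewrite -sqrf_eq0; apply/eqP; nra.
by apply: contra_neq h => e; nra.
Qed.

(** If p0 = 1, then p1 = 0 and the inverted formula reduces to (0, -p2/2). Elsewhere p1^2 = -(1 -
    p0)(1 + p0) turns the inversion of the affine formula into the inverted one. *)
Lemma chart_coord_stereo k p : sphere p -> chart_dom k (stereo p) ->
  chart_coord k (stereo p) = stereo_coord k p.
Proof.
move=> sp /(chart_dom_stereo k p sp); move/sphereE: sp => sp.
move=> dk; rewrite /stereo /stereo_coord; case: eqVneq => [p0|p0]; move: dk.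
  case: k; rewrite /= p0 ?mul1r ?subrr ?eqxx // => _.
  have p1 : p 0 1 = 0.
    by apply/eqP; rewrite -sqrf_eq0; apply/eqP; move: sp; rewrite p0; lra.
  by rewrite p1 !mulN1r opprK oppr0 mul0r mulNr.
have d0 : 1 - p 0 0 != 0 by lra.
case: k; rewrite /= ?mul1r // !mulN1r opprK => d1.
rewrite /inversion vec2E0 vec2E1.
(* The inversion divides by x, hence by p1; on the sphere p1 = 0 would make 1 - p0 or 1 + p0
   vanish. *)
have p1 : p 0 1 != 0.
  apply: contra_neq d1 => p1; have /eqP : (1 - p 0 0) * (1 + p 0 0) = 0.
    by move: sp; rewrite p1; lra.
  by rewrite mulf_eq0 (negPf d0) => /eqP.
congr vec2; field: sp; exact/and3P.
Qed.

(** The inversion of the plane exchanges the inverse formulas for the two signs, so the two branches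
    of [stereo_inv] glue. *)
Lemma stereo_inv_chart_param k q : Q q ->
  stereo_inv (chart_param k q) = stereo_inv_coord k q.
Proof.
move=> /QE qQ; case: k => //=; case: eqVneq => [q0|q0] /=.
  by rewrite -[in RHS](vec2_eta q) q0.
rewrite /stereo_inv_coord /inversion !vec2E0 !vec2E1 /=.
by congr vec3; field; rewrite qQ q0 /=; apply: contra_neq qQ => h; lra.
Qed.

Lemma stereo_inv_coord_den k q : Q q ->
  1 - chart_sign k * stereo_inv_coord k q 0 0 = - 2 / (q 0 0 ^+ 2 - 1).
Proof.
move=> /QE qQ; rewrite /stereo_inv_coord vec3E.
by have kE := chart_sign_sqr k; field: kE.
Qed.

Lemma stereo_inv_coordK k q : Q q ->
  stereo_coord k (stereo_inv_coord k q) = q.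
Proof.
move=> /QE qQ; have kE := chart_sign_sqr k.
rewrite -[RHS]vec2_eta /stereo_coord stereo_inv_coord_den //; last exact/QE.
by rewrite /stereo_inv_coord !vec3E; congr vec2; field: kE.
Qed.

Lemma stereo_coordK k p : sphere p -> 1 - chart_sign k * p 0 0 != 0 ->
  stereo_inv_coord k (stereo_coord k p) = p.
Proof.
move=> /sphereE sp d0; rewrite -[RHS]vec3_eta /stereo_inv_coord /stereo_coord.
rewrite !vec2E0 !vec2E1; have kE := chart_sign_sqr k.
(* On the sphere (e p1)^2 = (e p0)^2 - 1 = -(1 - e p0)(1 + e p0); one factor cancels. *)
have -> : (chart_sign k * p 0 1 / (1 - chart_sign k * p 0 0)) ^+ 2
   = - (1 + chart_sign k * p 0 0) / (1 - chart_sign k * p 0 0) by field: sp kE.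
have -> : - (1 + chart_sign k * p 0 0) / (1 - chart_sign k * p 0 0) - 1
   = - 2 / (1 - chart_sign k * p 0 0) by field.
by congr vec3; field: kE.
Qed.

Lemma sphere_stereo_inv_coord k q : Q q -> sphere (stereo_inv_coord k q).
Proof.
move=> /QE qQ; apply/sphereE; rewrite /stereo_inv_coord !vec3E.
by have kE := chart_sign_sqr k; field: kE.
Qed.

(** The image lies in the domain of the chart [k], so comparing coordinates in that chart
    suffices. *)
Lemma stereo_stereo_inv_coord k q : Q q ->
  stereo (stereo_inv_coord k q) = chart_param k q.
Proof.
move=> qQ; have sq := sphere_stereo_inv_coord k q qQ.
have dq : chart_dom k (stereo (stereo_inv_coord k q)).
  apply/(chart_dom_stereo k _ sq); rewrite stereo_inv_coord_den //.
  by move/QE: qQ => qQ; rewrite mulf_neq0 ?invr_eq0 // oppr_eq0 pnatr_eq0.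
by rewrite -[LHS](chart_coordK dq) chart_coord_stereo // stereo_inv_coordK.
Qed.

Lemma C2_chart c : C2 c ->
  exists2 k, chart_dom k c & chart_param k (chart_coord k c) = c.
Proof.
by rewrite C2_chart_dom => -[|] dc; [exists Affine|exists Inverted] => //;
  exact: chart_coordK.
Qed.

Lemma stereo_C2 p : sphere p -> C2 (stereo p).
Proof.
move=> sp; rewrite C2_chart_dom.
have [p0|p0] := eqVneq (p 0 0) 1; [right|left].
  by apply/(chart_dom_stereo Inverted p sp); rewrite /= p0.
by apply/(chart_dom_stereo Affine p sp); rewrite /= mul1r subr_eq0 eq_sym.
Qed.

Lemma stereoK p : sphere p -> stereo_inv (stereo p) = p.
Proof.
move=> sp; have [k dp <-] := C2_chart _ (stereo_C2 p sp).
rewrite stereo_inv_chart_param; last exact: chart_coord_Q.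
rewrite chart_coord_stereo // stereo_coordK //.
exact/(chart_dom_stereo k p sp).
Qed.

Lemma stereo_bij : set_bij (@sphere R) (@C2 R) stereo.
Proof.
split; first exact: stereo_C2.
  by move=> p p' /set_mem sp /set_mem sp' e; rewrite -(stereoK p sp) e stereoK.
move=> c /C2_chart[k dc <-]; have qQ := chart_coord_Q dc.
exists (stereo_inv_coord k (chart_coord k c)).
  exact: sphere_stereo_inv_coord.
exact: stereo_stereo_inv_coord.
Qed.

(** * Smoothness of both maps *)

Lemma open_Q : open (@Q R).
Proof.
rewrite (_ : @Q R = [set q : 'rV[R]_2 | q 0 0 ^+ 2 - 1 != 0]); last first.
  by apply/funext => q; exact/propext/QE.
by apply: open_rational_neq0; rational_tac.
Qed.

(** An open set of the ambient space rather than of the sphere: there [stereo_coord k] is the smooth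
    extension that [smooth_on] asks for. *)
Definition stereo_dom k : set 'rV[R]_3 :=
  [set p | 1 - chart_sign k * p 0 0 != 0].

Lemma open_stereo_dom k : open (stereo_dom k).
Proof. by apply: open_rational_neq0; rational_tac. Qed.

Lemma smooth_stereo_coord k j :
  smooth (stereo_dom k) (fun p => stereo_coord k p 0 j).
Proof.
apply: rational_smooth; first exact: open_stereo_dom.
by case: j => [[|[|j]] lj] //;
  under eq_fun do rewrite mxE /=; rational_tac.
Qed.

Lemma smooth_stereo_inv_coord k j :
  smooth (@Q R) (fun q => stereo_inv_coord k q 0 j).
Proof.
apply: rational_smooth; first exact: open_Q.
by case: j => [[|[|[|j]]] lj] //;
  under eq_fun do rewrite mxE /=; rational_tac => q /QE.
Qed.

Lemma stereo_diffeomorphism : diffeomorphism (@stereo R).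
Proof.
split; first exact: stereo_bij.
- move=> p k sp /(chart_dom_stereo k p sp) dp.
  exists (stereo_dom k); split=> //; first exact: open_stereo_dom.
    by move=> p' sp' /(chart_dom_stereo k p' sp').
  move=> p' [sp' dp']; exists (stereo_dom k), (stereo_coord k); split=> //.
  + exact: open_stereo_dom.
  + exact: smooth_stereo_coord.
  + move=> x [sx dx] _ /=; rewrite chart_coord_stereo //.
    exact/(chart_dom_stereo k x sx).
- exists stereo_inv; split; first exact: stereoK.
  move=> k q qQ; exists (@Q R), (stereo_inv_coord k); split=> //.
  + exact: open_Q.
  + exact: smooth_stereo_inv_coord.
  + by move=> x xQ _ /=; rewrite stereo_inv_chart_param.
Qed.

(** * The conformal factor along curves *)

Lemma linear_elementE (g : R -> 'rV[R]_3) t : derivable g t 1 ->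
  linear_element g t =
    'D_1 (fun s => g s 0 0) t ^+ 2 - 'D_1 (fun s => g s 0 1) t ^+ 2.
Proof.
by move=> dg; rewrite /linear_element derive1E derive_mx // /scal !mxE.
Qed.

(** Differentiate p0^2 - p1^2 = 1 along the curve and halve. *)
Lemma sphere_curve_derive (g : R -> 'rV[R]_3) (t a' b' : R) :
  (forall s, sphere (g s)) ->
  is_derive t 1 (fun s => g s 0 0) a' -> is_derive t 1 (fun s => g s 0 1) b' ->
  g t 0 0 * a' = g t 0 1 * b'.
Proof.
move=> sg da db.
have := is_deriveB (is_deriveM da da) (is_deriveM db db).
rewrite (_ : _ - _ = cst 1); last by apply/funext => s; exact: sg.
case=> _; rewrite derive_cst /GRing.scale /=; lra.
Qed.

Lemma stereo_conformal_factor k :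
  conformal_factor (@stereo R) k (fun q => 4 / (q 0 0 ^+ 2 - 1) ^+ 2).
Proof.
move=> g t sg dg dt.
have dgij := (derivable_mxP g t 1).1 dg.
pose e := chart_sign k; have kE : e ^+ 2 = 1 := chart_sign_sqr k.
have D0 : 1 - e * g t 0 0 != 0 by exact/(chart_dom_stereo k _ (sg t)).
pose a' := 'D_1 (fun s => g s 0 0) t; pose b' := 'D_1 (fun s => g s 0 1) t.
have da : is_derive t 1 (fun s => g s 0 0) a' by exact: derivableP.
have db : is_derive t 1 (fun s => g s 0 1) b' by exact: derivableP.
have dD : is_derive t 1 (fun s => 1 - e * g s 0 0) (- (e * a')).
  have := is_deriveB (is_derive_cst (1 : R) t 1) (is_deriveZ e da).
  by rewrite sub0r.
have dV := @is_deriveV R (fun s => 1 - e * g s 0 0) _ _ _ D0 dD.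
(* The curve may leave the chart, so its coordinates are known to agree with the rational formula
   only near [t]; this determines the derivative at [t]. *)
pose h s := plane_pt (stereo_coord k (g s)).
have nh : \near t, h t = plane_pt (chart_coord k (stereo (g t))).
  have : \near t, stereo_dom k (g t).
    apply: (differentiable_continuous ((derivable1_diffP _ _).1 dg)).
    by apply: open_nbhs_nbhs; split=> //; exact: open_stereo_dom.
  apply: filterS => s ds; rewrite /h chart_coord_stereo //.
  exact/(chart_dom_stereo k _ (sg s)).
have dh1 : is_derive t 1 (fun s => h s 0 1)
   ((e * b' * (1 - e * g t 0 0) + g t 0 1 * a') / (1 - e * g t 0 0) ^+ 2).
  have := is_deriveM (is_deriveZ e db) dV.
  rewrite (_ : (_ * _) = (fun s => h s 0 1)); last first.
    by apply/funext => s; rewrite /h /plane_pt vec3E vec2E0.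
  by move=> /is_derive_eq; apply; rewrite /= !/GRing.scale /=; field: kE.
(* The linear element reads only the first two components, but differentiating entrywise requires
   the whole curve to be derivable. *)
have dh : derivable h t 1.
  apply/derivable_mxP => i; rewrite (ord1 i) => -[[|[|[|j]]] lj] //.
  - by under eq_fun do rewrite mxE /=; exact: derivable_cst.
  - by rewrite (_ : Ordinal lj = 1); [case: dh1|exact: val_inj].
  - under eq_fun do rewrite mxE /= vec2E1.
    apply: derivableM; last by case: dV.
    by apply: derivableZ; exact: dgij.
rewrite /linear_element !derive1E -(near_eq_derive _ nh).
rewrite -!derive1E -!/(linear_element _ _) !linear_elementE //.
have -> : (fun s => h s 0 0) = cst 0.
  by apply/funext => s; rewrite /h /plane_pt vec3E.
rewrite derive_cst chart_coord_stereo // /stereo_coord vec2E0.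
have [_ ->] := dh1; rewrite -/a' -/b' -/e.
have /sphereE sp := sg t; have rel := sphere_curve_derive g t a' b' sg da db.
have -> : (e * g t 0 1 / (1 - e * g t 0 0)) ^+ 2 - 1 = - 2 / (1 - e * g t 0 0).
  by field: kE sp.
(* [N] is the numerator of dx, whose denominator is (1 - e p0)^2, while the factor 4 / (x^2 - 1)^2
   equals (1 - e p0)^2. *)
set N := e * b' * _ + _.
have NE : N ^+ 2 = (b' ^+ 2 - a' ^+ 2) * (1 - e * g t 0 0) ^+ 2.
  (* The cross term is grouped to exhibit p1 b', which [rel] replaces by p0 a'; with p1^2 = p0^2 - 1
     the terms in a'^2 then sum to -(1 - e p0)^2 a'^2. *)
  transitivity (b' ^+ 2 * (1 - e * g t 0 0) ^+ 2 +
    2 * e * (1 - e * g t 0 0) * a' * (g t 0 1 * b') + g t 0 1 ^+ 2 * a' ^+ 2).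
    by rewrite /N; ring: kE.
  by rewrite -rel; ring: kE sp.
by field: NE.
Qed.

Lemma stereo_conformal_map : conformal_map (@stereo R).
Proof.
split=> [|k]; first exact: stereo_diffeomorphism.
exists (fun q => 4 / (q 0 0 ^+ 2 - 1) ^+ 2); split.
- move=> q /QE qQ; rewrite divr_gt0 ?ltr0n //.
  by rewrite lt0r sqr_ge0 sqrf_eq0 qQ.
- apply: rational_smooth; first exact: open_Q.
  by rational_tac => q /QE qQ; rewrite sqrf_eq0.
- exact: stereo_conformal_factor.
Qed.

End Stereographic.

Theorem mainTheorem1 (R : realType) :
  conformal_map (@stereo R) /\
  conformal_factor (@stereo R) Affine
    (fun q : 'rV[R]_2 => 4 / (q ord0 ord0 ^+ 2 - 1) ^+ 2).
Proof.
split; first exact: stereo_conformal_map.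
exact: stereo_conformal_factor.
Qed.
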